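(* Let $E$ be a (finite-dimensional) Euclidean space, let $\Omega$ be a nonempty, closed, bounded and convex subset of $E$, and let $\rho$ be a norm on $E$. Then the following statements are equivalent: (i) There exists some $x_0\in E$ for which the problem $$\inf\{\rho(x_0-x):\ x\in\Omega\}$$ has more than one minimizer. (ii) There exist a vector $a\in E\setminus\{0\}$, distinct points $w_1,w_2\in\Omega$, distinct points $u_1,u_2\in\partial\bar B_\rho(0,1)$ and a real number $r\neq 0$ such that the following three conditions hold: (a) $\Omega\subset H^+(a,w_1\cdot a)$ and $[w_1,w_2]\subset H(a,w_1\cdot a)$; (b) $B_\rho(0,1)\subset H^-(a,u_1\cdot a)$ and $[u_1,u_2]\subset H(a,u_1\cdot a)$; (c) $w_1-w_2=r(u_1-u_2)$.
   Context: The scalar product of $E$ is denoted $x\cdot y$. $B_\rho(0,1)=\{x\in E:\rho(x)<1\}$ is the open unit ball of $\rho$ and $\partial\bar B_\rho(0,1)=\{x\in E:\rho(x)=1\}$ its unit sphere. For $a\in E\setminus\{0\}$ and $\alpha\in\mathbb{R}$, set $H(a,\alpha)=\{x\in E:x\cdot a=\alpha\}$, $H^+(a,\alpha)=\{x\in E:x\cdot a\ge\alpha\}$ and $H^-(a,\alpha)=\{x\in E:x\cdot a\le\alpha\}$. For $p,q\in E$, $[p,q]=\{p+t(q-p):t\in[0,1]\}$. *)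

(* Defs.v *)
From HB Require Import structures.
From mathcomp Require Import all_boot all_order all_algebra.
From mathcomp Require Import sesquilinear ring.
From mathcomp Require Import all_classical all_reals all_analysis.

Set Implicit Arguments.
Unset Strict Implicit.
Unset Printing Implicit Defensive.

Import Order.TTheory GRing.Theory Num.Theory.
Import numFieldNormedType.Exports.

Local Open Scope classical_set_scope.
Local Open Scope ring_scope.

(* [euclidean dot] is [E] carrying the norm x |-> sqrt (x . x), hence also its
   topology; [closed] and [bounded_set] are meant with respect to it. *)
Definition euclidean (R : realType) (E : vectType R)
  (dot : {dot E for idfun}) : Type := E.

Section EuclideanNorm.
Variables (R : realType) (E : vectType R) (dot : {dot E for idfun}).

Definition euclidean_norm (x : E) : R := Num.sqrt (dot x x).

Lemma dot_ge0 (x : E) : 0 <= dot x x.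
Proof.
have [->|x0] := eqVneq x 0; first by rewrite linear0r.
exact/ltW/neq0_dnorm_gt0.
Qed.

Lemma dotC (x y : E) : dot x y = dot y x.
Proof. by rewrite hermC /= expr0 mul1r. Qed.

Lemma dot_Cauchy_Schwarz (x y : E) : dot x y ^+ 2 <= dot x x * dot y y.
Proof.
have [->|y0] := eqVneq y 0; first by rewrite !linear0r expr0n.
have yy0 : 0 < dot y y by exact: neq0_dnorm_gt0.
have := dot_ge0 (dot y y *: x - dot x y *: y).
rewrite hnormB /= !(linearZl_LR, linearZr_LR) /= expr0 mul1r /GRing.scale /=.
set a := dot x x; set b := dot x y; set c := dot y y => h.
have : 0 <= c * (a * c - b ^+ 2).
  apply: le_trans h _; rewrite le_eqVlt; apply/orP; left; apply/eqP.
  ring.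
by rewrite pmulr_rge0// subr_ge0.
Qed.

Lemma euclidean_normD (x y : E) :
  euclidean_norm (x + y) <= euclidean_norm x + euclidean_norm y.
Proof.
rewrite /euclidean_norm -[leRHS]ger0_norm ?addr_ge0 ?sqrtr_ge0//.
rewrite -sqrtr_sqr ler_wsqrtr// hnormD /= expr0 mul1r sqrrD.
rewrite !sqr_sqrtr ?dot_ge0// addrAC lerD2r lerD2l -mulr2n lerMn2r /=.
rewrite -sqrtrM ?dot_ge0// (le_trans (ler_norm _))// -sqrtr_sqr.
by rewrite ler_wsqrtr// dot_Cauchy_Schwarz.
Qed.

Lemma euclidean_normZ (l : R) (x : E) :
  euclidean_norm (l *: x) = `|l| * euclidean_norm x.
Proof.
rewrite /euclidean_norm linearZl_LR linearZr_LR /= mulrA -expr2.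
by rewrite sqrtrM ?sqr_ge0// sqrtr_sqr.
Qed.

Lemma euclidean_norm_eq0 (x : E) : euclidean_norm x = 0 -> x = 0.
Proof.
move=> /eqP; rewrite sqrtr_eq0; apply: contraTeq => x0.
by rewrite -ltNge neq0_dnorm_gt0.
Qed.

HB.instance Definition _ := Vector.copy (euclidean dot) E.
HB.instance Definition _ := Lmodule_isNormed.Build R (euclidean dot)
  euclidean_normD euclidean_normZ euclidean_norm_eq0.

Lemma euclidean_normE (x : euclidean dot) : `|x| = Num.sqrt (dot x x).
Proof. by []. Qed.

End EuclideanNorm.

(* Same axioms as the factory [Lmodule_isNormed], as a predicate so that a
   second norm can be put on a space; nonnegativity follows from them. *)
Record is_norm (R : realType) (V : lmodType R) (rho : V -> R) : Prop := {
  is_normD : forall x y, rho (x + y) <= rho x + rho y ;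
  is_normZ : forall (l : R) x, rho (l *: x) = `|l| * rho x ;
  is_norm_eq0 : forall x, rho x = 0 -> x = 0
}.

Definition open_unit_ball (R : realType) (V : lmodType R) (rho : V -> R) :
  set V := [set x | rho x < 1].

Definition unit_sphere (R : realType) (V : lmodType R) (rho : V -> R) :
  set V := [set x | rho x = 1].

Section Hyperplanes.
Variables (R : realType) (E : vectType R) (dot : {dot E for idfun}).

Definition hyperplane (a : E) (alpha : R) : set E :=
  [set x | dot x a = alpha].

Definition halfspace_ge (a : E) (alpha : R) : set E :=
  [set x | dot x a >= alpha].

Definition halfspace_le (a : E) (alpha : R) : set E :=
  [set x | dot x a <= alpha].

End Hyperplanes.

Definition segment (R : realType) (V : lmodType R) (p q : V) : set V :=
  [set p + t *: (q - p) | t in `[0 : R, 1]].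

Definition minimizers (R : realType) (T : Type) (f : T -> R) (A : set T) :
  set T := [set x | A x /\ forall y, A y -> f x <= f y].

(* Main.v *)
From HB Require Import structures.
Require Import Defs.
From mathcomp Require Import all_boot all_order all_algebra.
From mathcomp Require Import sesquilinear.
From mathcomp Require Import all_classical all_reals all_analysis.

Set Implicit Arguments.
Unset Strict Implicit.
Unset Printing Implicit Defensive.

Import Order.TTheory GRing.Theory Num.Theory.
Import numFieldNormedType.Exports.

Local Open Scope classical_set_scope.
Local Open Scope ring_scope.

(** Write d for the minimal value of rho (x0 - x) on Omega. Two distinct
    minimizers force d > 0, and then Omega does not meet the open rho-ball of
    centre x0 and radius d. A hyperplane separating these two convex sets has
    to contain every minimizer, since a minimizer lies in Omega and in the
    closed ball. So it supports both sets along the segment of minimizers, and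
    x |-> (x - x0) / d, which takes the ball to the unit ball, carries the two
    minimizers to u1 and u2; hence r = d ([minimizers_support]). Conversely,
    one may take r > 0, up to exchanging u1 and u2. The parallel segments
    [w1, w2] and [u1, u2] give a single point x0 = w1 - r u1 = w2 - r u2, and
    the ball of centre x0 and radius r lies on the other side of the hyperplane
    from Omega, touching it at w1 and w2, so both are at the minimal distance r
    ([support_minimizer]).

    The separation is obtained in functional form: a linear form below rho
    everywhere and at least d on Omega - x0 ([sublinear_separation]). It rests
    on a single construction, [sublinear_lower]: a sublinear function q that is
    at least d on a convex set C can be lowered to a sublinear p such that
    every linear form below p is at least d on C. Used with Omega - x0 it takes
    care of the constraint; used with the singletons of the vectors of a basis
    it makes q linear, one direction after the other, which is the
    Hahn-Banach theorem in finite dimension. *)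

(** * Sublinear functions and norms *)

Record sublinear (R : realType) (V : lmodType R) (q : V -> R) : Prop := {
  sublinearD : forall x y, q (x + y) <= q x + q y ;
  sublinearZ : forall (t : R) x, 0 <= t -> q (t *: x) = t * q x
}.

Lemma sublinear0 (R : realType) (V : lmodType R) (q : V -> R) :
  sublinear q -> q 0 = 0.
Proof. by move=> qs; rewrite -(scale0r 0) (sublinearZ qs)// mul0r. Qed.

Lemma sublinearN_ge0 (R : realType) (V : lmodType R) (q : V -> R) (x : V) :
  sublinear q -> 0 <= q x + q (- x).
Proof. by move=> qs; rewrite -(sublinear0 qs) -(subrr x) (sublinearD qs). Qed.

Lemma norm_sublinear (R : realType) (V : lmodType R) (rho : V -> R) :
  is_norm rho -> sublinear rho.
Proof.
move=> rhoN; split; first exact: is_normD rhoN.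
by move=> t x t0; rewrite (is_normZ rhoN) ger0_norm.
Qed.

Lemma is_normN (R : realType) (V : lmodType R) (rho : V -> R) (x : V) :
  is_norm rho -> rho (- x) = rho x.
Proof. by move=> rhoN; rewrite -scaleN1r (is_normZ rhoN) normrN1 mul1r. Qed.

Lemma is_norm_gt0 (R : realType) (V : lmodType R) (rho : V -> R) (x : V) :
  is_norm rho -> x <> 0 -> 0 < rho x.
Proof.
move=> rhoN x0; rewrite lt_neqAle; apply/andP; split.
  by apply/eqP => /esym/(is_norm_eq0 rhoN).
have := sublinearN_ge0 x (norm_sublinear rhoN).
by rewrite (is_normN x rhoN) -mulr2n pmulrn_lge0.
Qed.

(** * Separation by a linear form *)

(** Convexity for coefficients that are not normalised, so that no division is
    needed when two elements of the cone over C are added. *)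
Lemma convex_set_comb (R : realType) (V : lmodType R) (C : set V)
    (x y : V) (s t : R) :
  convex_set C -> C x -> C y -> 0 <= s -> 0 <= t ->
  exists2 z, C z & (s + t) *: z = s *: x + t *: y.
Proof.
move=> Cconv Cx Cy s0 t0.
have st0 : 0 <= s + t by exact: addr_ge0.
have [st|st] := eqVneq (s + t) 0.
  have /andP[/eqP s00 /eqP t00] : (s == 0) && (t == 0).
    by rewrite -paddr_eq0// st.
  by exists x => //; rewrite s00 t00 addr0 !scale0r addr0.
have k01 : 0 <= s / (s + t) <= 1.
  rewrite divr_ge0//= ler_pdivrMr ?mul1r ?lerDl//.
  by rewrite lt_neqAle eq_sym st.
pose k : {i01 R} := Itv01 (andP k01).1 (andP k01).2.
exists (conv k (x : convex_lmodType V) (y : convex_lmodType V)).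
  by apply/set_mem/Cconv; exact/mem_set.
rewrite /conv /= scalerDr !scalerA mulrBr mulr1 mulrCA divff// mulr1.
by rewrite addrAC subrr add0r.
Qed.

(** The witness is p v = inf (q (v + t *: x) - t * d) over t >= 0 and x in C.
    The bound d <= q on C makes this infimum finite, as
    t * d <= q (t *: x) <= q (v + t *: x) + q (- v), and convexity of C makes
    it subadditive; t = 0 gives p <= q, and t = 1 at v = - x gives the bound
    on - C. A linear form below p then satisfies f (- x) <= - d, that is
    d <= f x, for x in C. *)
Lemma sublinear_lower (R : realType) (V : lmodType R) (q : V -> R)
    (C : set V) (d : R) :
  sublinear q -> convex_set C -> C !=set0 -> (forall x, C x -> d <= q x) ->
  exists p : V -> R, [/\ sublinear p, forall v, p v <= q v
    & forall x, C x -> p (- x) <= - d].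
Proof.
move=> qs Cconv [c Cc] dq.
pose S v := [set r | exists t x, [/\ 0 <= t, C x & r = q (v + t *: x) - t * d]].
have lbS v : lbound (S v) (- q (- v)).
  move=> _ [t [x [t0 Cx ->]]].
  rewrite lerBrDl -lerBrDr opprK.
  rewrite (le_trans _ (_ : q (t *: x) <= _))//.
    by rewrite (sublinearZ qs)// ler_wpM2l// dq.
  by rewrite -[X in q X](addrK v) (addrC (t *: x)) (sublinearD qs).
have hasS v : has_lbound (S v) by exists (- q (- v)).
have S0 v : S v !=set0 by exists (q (v + 0 *: c) - 0 * d), 0, c.
pose p v := inf (S v).
have ple v t x : 0 <= t -> C x -> p v <= q (v + t *: x) - t * d.
  by move=> t0 Cx; apply: ge_inf => //; exists t, x.
have pge v r : (forall t x, 0 <= t -> C x -> r <= q (v + t *: x) - t * d) ->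
    r <= p v.
  by move=> h; apply: lb_le_inf => // _ [t [x [t0 Cx ->]]]; exact: h.
have pZ_le t v : 0 < t -> t * p v <= p (t *: v).
  move=> t0; apply: pge => s x s0 Cx.
  (* Scaling by t maps the parameter s / t for v to the parameter s for
     t *: v. *)
  have -> : q (t *: v + s *: x) - s * d
      = t * (q (v + (s / t) *: x) - s / t * d).
    rewrite mulrBr -(sublinearZ qs) ?ltW// scalerDr scalerA !mulrA.
    by rewrite (mulrC t s) mulfK ?gt_eqF.
  by rewrite ler_pM2l// ple// divr_ge0// ltW.
have pq v : p v <= q v.
  by have := ple v 0 c (lexx 0) Cc; rewrite scale0r addr0 mul0r subr0.
have p0 : p 0 = 0.
  apply/eqP; rewrite eq_le -{1}(sublinear0 qs) pq/= pge// => t x t0 Cx.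
  by rewrite add0r (sublinearZ qs)// -mulrBr mulr_ge0// subr_ge0 dq.
exists p; split => //; first split.
- move=> u v; rewrite -lerBlDr; apply: (pge) => s x s0 Cx.
  rewrite lerBlDr -lerBlDl; apply: (pge) => t y t0 Cy.
  rewrite lerBlDl.
  (* The values at (s, x) and (t, y) are dominated through the single
     parameter s + t, at the barycentre z of x and y. *)
  have [z Cz zE] := convex_set_comb Cconv Cx Cy s0 t0.
  apply: (le_trans (ple _ (s + t) z (addr_ge0 s0 t0) Cz)).
  rewrite zE mulrDl opprD [leRHS]addrACA lerD2r addrACA.
  exact: sublinearD qs _ _.
- move=> t v; rewrite le_eqVlt => /predU1P[<-|t0].
    by rewrite scale0r mul0r.
  (* The inequality for t^-1 at t *: v is the converse one for t at v. *)
  apply/eqP; rewrite eq_le pZ_le// andbT.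
  have := pZ_le t^-1 (t *: v); rewrite invr_gt0 => /(_ t0).
  by rewrite scalerA mulVf ?gt_eqF// scale1r ler_pdivrMl.
- move=> x Cx; have := ple (- x) 1 x ler01 Cx.
  by rewrite scale1r addNr (sublinear0 qs) mul1r add0r.
Qed.

(** Since 0 <= p e + p (- e) for every sublinear p, the conclusion says that p
    is linear along each e of s. One direction is treated by lowering q with
    C = {e} and d = q e; the bound obtained there survives further lowering,
    because p e and p (- e) can only decrease. *)
Lemma sublinear_linearize (R : realType) (V : lmodType R) (s : seq V)
    (q : V -> R) :
  sublinear q ->
  exists p : V -> R, [/\ sublinear p, forall v, p v <= q v
    & forall e, e \in s -> p (- e) <= - p e].
Proof.
elim: s q => [|e s IHs] q qs; first by exists q.
have [|||r [rs rq re]] := @sublinear_lower _ _ _ [set e] (q e) qs.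
- move=> x y k; rewrite !inE => -> ->.
  by rewrite /conv /= -scalerDl addrC subrK scale1r.
- by exists e.
- by move=> _ ->.
have [p [ps pr pe]] := IHs r rs.
exists p; split => // [v|f]; first exact: le_trans (pr v) (rq v).
rewrite inE => /predU1P[->|/pe//].
rewrite (le_trans (pr _))// (le_trans (re e erefl))// lerN2.
exact: le_trans (pr e) (rq e).
Qed.

(** The Riesz representation, in coordinates: the endomorphism
    a |-> sum_i (e_i . a) e_i has trivial kernel, for a vector orthogonal to a
    basis is orthogonal to itself; by dimension it is onto. *)
Lemma dot_vbasis_surj (R : realType) (E : vectType R)
    (dot : {dot E for idfun}) (alpha : 'I_(\dim {:E}) -> R) :
  exists a : E, forall i : 'I_(\dim {:E}), dot (vbasis {:E})`_i a = alpha i.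
Proof.
set e := vbasis {:E}.
have efree : free e by exact: basis_free (vbasisP _).
pose g (a : E) : E := \sum_(i < \dim {:E}) dot e`_i a *: e`_i.
have glin : linear g.
  move=> k a b; rewrite /g scaler_sumr -big_split; apply: eq_bigr => i _ /=.
  by rewrite linearDr linearZr_LR /= scalerDl scalerA.
pose gL : {linear E -> E} := HB.pack g (GRing.isLinear.Build _ _ _ _ g glin).
have gker : lker (linfun gL) == 0%VS.
  rewrite -subv0; apply/subvP => a; rewrite memv_ker lfunE /= memv0 => /eqP ga0.
  have ea0 := freeP efree _ ga0.
  apply: contraT => a0; have := neq0_dnorm_gt0 (s := dot) _ a0.
  rewrite {1}(coord_vbasis (memvf a)) linear_sumlz big1 ?ltxx// => i _.
  by rewrite linearZl_LR /= ea0 mulr0.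
have /memv_imgP[a _] : \sum_(i < \dim {:E}) alpha i *: e`_i \in limg (linfun gL).
  by rewrite lker0_limgf// memvf.
rewrite lfunE /= => aE; exists a => i.
by rewrite -(coord_sum_free alpha i efree) aE /g coord_sum_free.
Qed.

(** Hahn-Banach in finite dimension. Once q is lowered to a p that is linear
    along a basis, it suffices to represent the values of p on that basis:
    subadditivity gives p <= (. . a), and the same inequality at - x turns into
    (. . a) <= p. *)
Lemma sublinear_dot_minorant (R : realType) (E : vectType R)
    (dot : {dot E for idfun}) (q : E -> R) :
  sublinear q -> exists a : E, forall x, dot x a <= q x.
Proof.
move=> qs; have [p [ps pq pe]] := sublinear_linearize (vbasis {:E}) qs.
have [a aE] := dot_vbasis_surj dot (fun i : 'I_(\dim {:E}) => p (vbasis {:E})`_i).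
have pa x : p x <= dot x a.
  rewrite {1 2}(coord_vbasis (memvf x)) linear_sumlz /=.
  have psum : forall (I : Type) (l : seq I) (F : I -> E),
      p (\sum_(i <- l) F i) <= \sum_(i <- l) p (F i).
    move=> I l F; elim/big_rec2: _ => [|i y1 y2 _ h].
      by rewrite (sublinear0 ps).
    by rewrite (le_trans (sublinearD ps _ _))// lerD2l.
  apply: (le_trans (psum _ _ _)); apply: ler_sum => i _.
  rewrite linearZl_LR /= aE; set c := coord _ _ _; set e := _`_i.
  have [c0|c0] := leP 0 c; first by rewrite (sublinearZ ps).
  (* A negative coefficient is moved to - e, where the bound p (- e) <= - p e
     replaces homogeneity. *)
  have Nc0 : 0 <= - c by rewrite oppr_ge0 ltW.
  rewrite -[X in X *: e]opprK scaleNr -scalerN (sublinearZ ps)//.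
  rewrite -[leRHS]mulrNN ler_wpM2l// pe//.
  by rewrite mem_nth// size_tuple.
exists a => x; rewrite (le_trans _ (pq x))//.
have := pa (- x); rewrite linearNl => h.
have := sublinearN_ge0 x ps; rewrite -lerBlDr sub0r => /(le_trans _); apply.
by rewrite lerNr.
Qed.

Lemma sublinear_separation (R : realType) (E : vectType R)
    (dot : {dot E for idfun}) (q : E -> R) (C : set E) (d : R) :
  sublinear q -> convex_set C -> C !=set0 -> (forall x, C x -> d <= q x) ->
  exists a : E, (forall x, dot x a <= q x) /\ (forall x, C x -> d <= dot x a).
Proof.
move=> qs Cconv C0 dq; have [p [ps pq pC]] := sublinear_lower qs Cconv C0 dq.
have [a ap] := sublinear_dot_minorant dot ps.
exists a; split => x; first exact: le_trans (ap x) (pq x).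
by move=> /pC h; rewrite -lerN2 -linearNl (le_trans (ap _)).
Qed.

Lemma convex_set_translate (R : realType) (V : lmodType R) (C : set V) (c : V) :
  convex_set C -> convex_set [set x + c | x in C].
Proof.
move=> Cconv _ _ k /set_mem[x Cx <-] /set_mem[y Cy <-]; apply/mem_set.
exists (conv k (x : convex_lmodType V) (y : convex_lmodType V)).
  by apply/set_mem/Cconv; exact/mem_set.
rewrite /conv /= !scalerDr addrACA -scalerDl.
by rewrite [X in X *: c]addrC subrK scale1r.
Qed.

(** * Supporting hyperplanes and minimizers *)

Lemma segment_hyperplane (R : realType) (E : vectType R)
    (dot : {dot E for idfun}) (a p q : E) :
  segment p q `<=` hyperplane dot a (dot p a) <-> dot q a = dot p a.
Proof.
split=> [|qp _ [t _ <-]]; last first.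
  rewrite /hyperplane /= linearDl linearZl_LR /= linearBl /=.
  by rewrite qp subrr mulr0 addr0.
apply; exists 1; last by rewrite scale1r addrC subrK.
by rewrite /= in_itv /= ler01 lexx.
Qed.

(** The form (. . a) given by separation is squeezed at a minimizer: it is at
    least d since the minimizer is in Omega, and at most rho (xi - x0) = d. *)
Lemma minimizers_support (R : realType) (E : vectType R)
    (dot : {dot E for idfun}) (Omega : set E) (rho : E -> R) (x0 x1 x2 : E) :
  is_norm rho -> convex_set Omega -> x1 <> x2 ->
  minimizers (fun x => rho (x0 - x)) Omega x1 ->
  minimizers (fun x => rho (x0 - x)) Omega x2 ->
  exists (a : E) (d : R), [/\ a <> 0, 0 < d,
    rho (x1 - x0) = d /\ rho (x2 - x0) = d,
    dot (x1 - x0) a = d /\ dot (x2 - x0) a = d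
    & (forall x, Omega x -> d <= dot (x - x0) a) /\
      (forall x, dot x a <= rho x)].
Proof.
move=> rhoN Oconv x12 [Ox1 min1] [Ox2 min2].
have rhoC x : rho (x0 - x) = rho (x - x0) by rewrite -(is_normN _ rhoN) opprB.
set d := rho (x1 - x0).
have d2 : rho (x2 - x0) = d.
  by rewrite /d -!rhoC; apply/eqP; rewrite eq_le min1// min2.
have d0 : 0 < d.
  apply: (is_norm_gt0 rhoN) => x10; apply: x12; apply: (subIr x0).
  rewrite x10; apply/esym/(is_norm_eq0 rhoN).
  by rewrite d2 /d x10 (sublinear0 (norm_sublinear rhoN)).
have [|||a [arho aC]] := @sublinear_separation _ _ dot rho
    [set x - x0 | x in Omega] d (norm_sublinear rhoN).
- exact: convex_set_translate.
- by exists (x1 - x0), x1.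
- by move=> _ [x Ox <-]; rewrite /d -!rhoC min1.
have aO x : Omega x -> d <= dot (x - x0) a by move=> Ox; apply: aC; exists x.
have a1 : dot (x1 - x0) a = d by apply/eqP; rewrite eq_le arho aO.
have a2 : dot (x2 - x0) a = d.
  by apply/eqP; rewrite eq_le aO// andbT -d2 arho.
exists a, d; split=> // a0.
by move: d0; rewrite -a1 a0 linear0r ltxx.
Qed.

(** A nonzero linear form does not reach its supremum on an open ball: from z
    one can move a little further in the direction of a. *)
Lemma open_unit_ball_lt (R : realType) (E : vectType R)
    (dot : {dot E for idfun}) (rho : E -> R) (a z : E) (m : R) :
  is_norm rho -> a <> 0 -> open_unit_ball rho `<=` halfspace_le dot a m ->
  rho z < 1 -> dot z a < m.
Proof.
move=> rhoN a0 Bm z1.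
have ra0 : 0 < rho a by exact: is_norm_gt0.
(* The step k uses up half of the gap between rho z and 1. *)
pose k := (1 - rho z) / 2 / rho a.
have k0 : 0 < k by rewrite !divr_gt0// subr_gt0.
have : open_unit_ball rho (z + k *: a).
  rewrite /open_unit_ball /= (le_lt_trans (is_normD rhoN _ _))//.
  rewrite (is_normZ rhoN) gtr0_norm// /k divfK ?gt_eqF// -ltrBrDl.
  by rewrite ltr_pdivrMr// ltr_pMr ?subr_gt0// ltr1n.
move=> /Bm; rewrite /halfspace_le /= linearDl linearZl_LR /=; apply: lt_le_trans.
by rewrite ltrDl mulr_gt0// neq0_dnorm_gt0//; exact/eqP.
Qed.

(** A point x of Omega closer than r to the centre w - r *: u would, after
    rescaling, be in the open unit ball, hence strictly below u in the direction
    of a; then x would be strictly below w, against the support of Omega. *)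
Lemma support_minimizer (R : realType) (E : vectType R)
    (dot : {dot E for idfun}) (Omega : set E) (rho : E -> R)
    (a u w : E) (r : R) :
  is_norm rho -> a <> 0 -> 0 < r -> rho u = 1 -> Omega w ->
  Omega `<=` halfspace_ge dot a (dot w a) ->
  open_unit_ball rho `<=` halfspace_le dot a (dot u a) ->
  minimizers (fun x => rho (w - r *: u - x)) Omega w.
Proof.
move=> rhoN a0 r0 u1 Ow Owa Bu; split=> // x Ox.
have -> : rho (w - r *: u - w) = r.
  rewrite addrAC subrr add0r (is_normN _ rhoN) (is_normZ rhoN) u1 mulr1.
  by rewrite gtr0_norm.
rewrite /= leNgt; apply/negP => xr; have := Owa x Ox.
rewrite /halfspace_ge /= leNgt => /negP; apply.
have := open_unit_ball_lt (z := r^-1 *: (x - (w - r *: u))) rhoN a0 Bu.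
rewrite (is_normZ rhoN) gtr0_norm ?invr_gt0// -(is_normN _ rhoN) opprB.
rewrite ltr_pdivrMl// mulr1 => /(_ xr).
rewrite linearZl_LR /= ltr_pdivrMl// !linearBl linearZl_LR /=.
by rewrite opprB addrCA gtrDl subr_lt0.
Qed.

Theorem proposition4p5 (R : realType) (E : vectType R)
    (dot : {dot E for idfun}) (Omega : set E) (rho : E -> R)
    (Omega_nonempty : Omega !=set0)
    (Omega_closed : closed (Omega : set (euclidean dot)))
    (Omega_bounded : bounded_set (Omega : set (euclidean dot)))
    (Omega_convex : convex_set Omega)
    (rho_norm : is_norm rho) :
  (exists x0 : E, exists x1 x2 : E,
     [/\ x1 <> x2,
         minimizers (fun x => rho (x0 - x)) Omega x1
       & minimizers (fun x => rho (x0 - x)) Omega x2])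
  <->
  (exists (a w1 w2 u1 u2 : E) (r : R),
     [/\ a <> 0,
         [/\ Omega w1, Omega w2 & w1 <> w2],
         [/\ unit_sphere rho u1, unit_sphere rho u2 & u1 <> u2],
         r <> 0
       & [/\ Omega `<=` halfspace_ge dot a (dot w1 a) /\
               segment w1 w2 `<=` hyperplane dot a (dot w1 a),
             open_unit_ball rho `<=` halfspace_le dot a (dot u1 a) /\
               segment u1 u2 `<=` hyperplane dot a (dot u1 a)
           & w1 - w2 = r *: (u1 - u2)]]).
Proof.
split=> [[x0 [x1 [x2 [x12 m1 m2]]]]|].
  have [a [d [a0 d0 [r1 r2] [a1 a2] [aO arho]]]] :=
    minimizers_support dot rho_norm Omega_convex x12 m1 m2.
  have dN0 : d != 0 by rewrite gt_eqF.
  exists a, x1, x2, (d^-1 *: (x1 - x0)), (d^-1 *: (x2 - x0)), d.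
  have sph x : rho (x - x0) = d -> unit_sphere rho (d^-1 *: (x - x0)).
    move=> rx; rewrite /unit_sphere /= (is_normZ rho_norm) rx.
    by rewrite gtr0_norm ?invr_gt0// mulVf.
  have dotu x : dot (x - x0) a = d -> dot (d^-1 *: (x - x0)) a = 1.
    by move=> ax; rewrite linearZl_LR /= ax mulVf.
  have E12 : x1 - x2 = d *: (d^-1 *: (x1 - x0) - d^-1 *: (x2 - x0)).
    by rewrite -scalerBr scalerA divff// scale1r opprB addrA subrK.
  have w12 : dot x2 a = dot x1 a.
    by apply: (addIr (- dot x0 a)); rewrite -!linearBl /= a1 a2.
  split=> //.
  - by case: m1; case: m2.
  - split; [exact: sph|exact: sph|move=> u12].
    by apply: x12; apply/subr0_eq; rewrite E12 u12 subrr scaler0.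
  - exact/eqP.
  - split=> //; split; [|exact/segment_hyperplane| |].
    + by move=> x /aO; rewrite /halfspace_ge /= -{1}a1 !linearBl /= lerD2r.
    + move=> x x1'; rewrite /halfspace_le /= dotu//.
      exact: le_trans (arho x) (ltW x1').
    + by apply/segment_hyperplane; rewrite !dotu.
move=> [a [w1 [w2 [u1 [u2 [r [a0 [Ow1 Ow2 w12] [su1 su2 u12] /eqP r0]]]]]]].
move=> [[Owa /segment_hyperplane w21] [Bu /segment_hyperplane u21] E12].
(* Exchanging u1 and u2 changes the sign of r. *)
wlog r_gt0 : u1 u2 r r0 su1 su2 u12 Bu u21 E12 / 0 < r => [wl|].
  have [|r_gt0] := ltP 0 r; first exact: (wl u1 u2).
  apply: (wl u2 u1 (- r)) => //.
  - by rewrite oppr_eq0.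
  - by move=> /esym.
  - by rewrite u21.
  - by rewrite E12 scaleNr -scalerN opprB.
  - by rewrite oppr_gt0 lt_neqAle r0.
exists (w1 - r *: u1), w1, w2; split=> //.
  exact: (support_minimizer (dot := dot) (a := a)).
have -> : w1 - r *: u1 = w2 - r *: u2.
  apply/eqP; rewrite subr_eq -addrA (addrC w2) -subr_eq E12 scalerBr.
  by rewrite addrC.
by apply: (support_minimizer (dot := dot) (a := a)); rewrite ?w21 ?u21.
Qed.
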